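(* Let $\Psi=\{\psi_1,\dots,\psi_N\}$ be an iterated function system on $\mathbb{R}^d$ consisting of $N$ similitudes, each with the same scaling constant $c\in(0,1)$. Let $A$ be the invariant set of $\Psi$, and let $\mathbf{f}\in L^\infty(\mathbb{N}\times\mathbb{R})$ be the persistence landscape of the degree-$0$ persistence module $H_0$ of the Čech filtration of $A$. Let $\delta_1=\operatorname{diam}(A)$ and, for $k\in\{2,\dots,N\}$, $\delta_k=\inf\{\varepsilon>0 : C(A,\varepsilon)\le k-1\}$. Define $\mathcal{L}:L^\infty(\mathbb{N}\times\mathbb{R})\to L^\infty(\mathbb{N}\times\mathbb{R})$ by $\mathcal{L}\mathbf{g}=\mathbf{h}$, where $$h^{(j)}=\tau_{(0,\delta_j)}\quad (1\le j\le N),\qquad h^{(kN+l)}(x)=c\,g^{(k+1)}(c^{-1}x)\quad (k\in\mathbb{N},\ 1\le l\le N).$$ If $\Psi$ has well-separated images, then $\mathcal{L}\mathbf{f}=\mathbf{f}$.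
   Context: $\mathbb{N}=\{1,2,\dots\}$. A similitude of $\mathbb{R}^d$ with scaling constant $c$ is a map $\psi$ with $|\psi(x)-\psi(y)|=c|x-y|$ for all $x,y$. The invariant set of $\Psi$ is the unique nonempty compact $A\subset\mathbb{R}^d$ with $A=\bigcup_{i=1}^N\psi_i(A)$. For sets, $d(Y,Z)=\inf\{|y-z|:y\in Y,z\in Z\}$. $\Psi$ has well-separated images if $\min_{1\le j\neq k\le N} d(\psi_j(A),\psi_k(A))\ge \max_{1\le j\le N}\operatorname{diam}\psi_j(A)$. $\varepsilon$-components: a set $X\subset\mathbb{R}^d$ is $\varepsilon$-connected if it is not a union of two nonempty sets $Y,Z\subset X$ with $d(Y,Z)>\varepsilon$. $Y\subseteq X$ is an $\varepsilon$-component of $X$ if $Y$ is (nonempty and) $\varepsilon$-connected and $d(Y,X\setminus Y)>\varepsilon$. $C(X,\varepsilon)$ is the number of distinct $\varepsilon$-components of $X$. Čech filtration: for $X\subset\mathbb{R}^d$ and $\varepsilon\ge0$, the Čech complex at scale $\varepsilon$ is the simplicial complex of finite nonempty $\sigma\subseteq X$ with $\bigcap_{x\in\sigma}\overline{B(x,\varepsilon/2)}\ne\emptyset$ (closed balls of radius $\varepsilon/2$); it is empty for $\varepsilon<0$. Homology has $\mathbb{Z}_2$ coefficients. For $s\le t$, $M^{s,t}$ denotes the map on $H_0$ induced by the inclusion of the complex at scale $s$ into the one at scale $t$. Hat functions: $\tau_{(0,b)}(t)=\max(0,\min(t,b-t))$. Persistence landscape: the landscape of a persistence module is the sequence $\mathbf{f}=\{f^{(n)}\}_{n\in\mathbb{N}}$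 with $f^{(n)}(t)=\sup\{m\ge 0:\operatorname{rank}M^{t-m,t+m}\ge n\}$ (the supremum of the empty set being $0$). Convention for degree $0$: the class that never dies is assigned death time $D=\operatorname{diam}(A)$; that is, for $0\le s\le t$ with $t\ge D$, $\operatorname{rank}M^{s,t}$ is replaced by $\operatorname{rank}M^{s,t}-1$ in this formula (so $f^{(1)}=\tau_{(0,D)}$ for $A$). $L^\infty(\mathbb{N}\times\mathbb{R})$ is the space of sequences $\mathbf{g}=\{g^{(n)}\}_{n\in\mathbb{N}}\subset L^\infty(\mathbb{R})$ with $\|\mathbf{g}\|=\sup_n\|g^{(n)}\|_{L^\infty(\mathbb{R})}<\infty$. *)

(* Defs.v *)
From HB Require Import structures.
From mathcomp Require Import all_boot all_order all_algebra finmap.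
From mathcomp Require Import ring_quotient.
(* The notations of [monalg] clash with those of MathComp-Analysis. *)
From mathcomp.multinomials Require monalg. Import -(notations) monalg.
From mathcomp Require Import all_classical all_reals all_analysis.
From mathcomp Require Import ess_sup_inf measurable_realfun.

Set Implicit Arguments.
Unset Strict Implicit.
Unset Printing Implicit Defensive.

Import Order.TTheory GRing.Theory Num.Theory.
Import numFieldNormedType.Exports.

Local Open Scope classical_set_scope.
Local Open Scope ring_scope.

Section Rank.
Context (F : fieldType) (R : realType).

Definition lin_indep (W : lmodType F) n (w : 'I_n -> W) :=
  forall a : 'I_n -> F, \sum_i a i *: w i = 0 -> forall i, a i = 0.

(* Dimension of the image of [f], [+oo] if it is infinite-dimensional. *)
Definition rank (U W : lmodType F) (f : {linear U -> W}) : \bar R :=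
  ereal_sup [set n%:R%:E | n in
    [set n | exists v : 'I_n -> U, lin_indep (fun i => f (v i))]].

End Rank.

(* The library only provides the quotient [Quotient.quot] as a Z-module. *)
Section QuotientModule.
Context (F : nzRingType) (V : lmodType F) (S : submodClosed V).
Local Open Scope quotient_scope.

Lemma submod_oppr_closed : oppr_closed S.
Proof. by move=> x xS; rewrite -scaleN1r rpredZ. Qed.

Definition submod_zmod : zmodClosed V :=
  HB.pack_for (zmodClosed V) (GRing.SubmodClosed.sort S)
    (GRing.isOppClosed.Build V S submod_oppr_closed).

Definition lquot := Quotient.quot submod_zmod.
HB.instance Definition _ := GRing.Zmodule.on lquot.
HB.instance Definition _ := EqQuotient.on lquot.

Definition lquot_scale (a : F) (x : lquot) : lquot := \pi_lquot (a *: repr x).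

Lemma lquot_eqP (x y : V) :
  reflect (\pi_lquot x = \pi_lquot y) (x - y \in (S : {pred V})).
Proof.
by rewrite -[_ \in _]/(x - y \in submod_zmod) Quotient.idealrBE; exact: eqP.
Qed.

Lemma pi_lquotZ a (x : V) : \pi_lquot (a *: x) = lquot_scale a (\pi_lquot x).
Proof.
by apply/lquot_eqP; rewrite -scalerBr rpredZ//; apply/lquot_eqP; rewrite reprK.
Qed.

Lemma pi_lquotD (x y : V) : \pi_lquot (x + y) = \pi_lquot x + \pi_lquot y.
Proof. exact: Quotient.pi_add. Qed.

Lemma lquot_scaleA a b x : lquot_scale a (lquot_scale b x) = lquot_scale (a * b) x.
Proof.
rewrite -[x]reprK; move: (repr x) => u.
by rewrite -[lquot_scale b _]pi_lquotZ -!pi_lquotZ scalerA.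
Qed.

Lemma lquot_scale1 : left_id 1 lquot_scale.
Proof. by move=> x; rewrite -[x]reprK -!pi_lquotZ scale1r. Qed.

Lemma lquot_scaleDr : right_distributive lquot_scale +%R.
Proof.
move=> a x y; rewrite -[x]reprK -[y]reprK.
by rewrite -pi_lquotD -!pi_lquotZ scalerDr pi_lquotD.
Qed.

Lemma lquot_scaleDl x : {morph lquot_scale^~ x : a b / a + b}.
Proof. by move=> a b; rewrite -[x]reprK -!pi_lquotZ scalerDl pi_lquotD. Qed.

HB.instance Definition _ := GRing.Zmodule_isLmodule.Build F lquot
  lquot_scaleA lquot_scale1 lquot_scaleDr lquot_scaleDl.

Lemma pi_lquot_linear : linear (fun x : V => \pi_lquot x).
Proof. by move=> a x y; rewrite pi_lquotD pi_lquotZ. Qed.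

End QuotientModule.

Section Homology.
Local Open Scope fset_scope.
Local Open Scope ring_scope.
Context (V : choiceType).

(* Abstract simplicial complexes, possibly infinite, with vertices in [V]. *)
Record complex := Complex {
  simplices : set {fset V};
  complex_neq0 : forall s, simplices s -> s != fset0;
  complex_sub : forall s t, simplices s -> t `<=` s -> t != fset0 -> simplices t
}.

Definition chain : lmodType 'F_2 := malg {fset V} 'F_2.

(* Vertices have zero boundary, i.e., homology is not reduced. *)
Definition simplex_boundary (s : {fset V}) : chain :=
  if (#|` s| <= 1)%N then 0 else \sum_(x <- s) mkmalgU (s `\ x) 1.

(* [mcoeff s u] is the coefficient of [s] in [u], [msupp u] its finite support,
   and [mkmalgU s a] the chain [a * s]. *)
Definition boundary (u : chain) : chain :=
  \sum_(s <- msupp u) mcoeff s u *: simplex_boundary s.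

Lemma boundary_is_linear : linear boundary.
Proof.
have E (d : {fset {fset V}}) (u : chain) : msupp u `<=` d ->
    boundary u = \sum_(s <- d) mcoeff s u *: simplex_boundary s.
  move=> ud; rewrite /boundary (big_fset_incl _ ud)// => s _ su.
  by rewrite (mcoeff_outdom su) scale0r.
move=> a u v; pose d := msupp (a *: u + v) `|` msupp u `|` msupp v.
rewrite (E d) ?(E d u) ?(E d v) ?scaler_sumr -?big_split/=; last 3 first.
- by rewrite /d fsubsetUr.
- by rewrite /d -fsetUA fsubsetU// fsubsetUl orbT.
- by rewrite /d -fsetUA fsubsetUl.
by apply: eq_bigr => s _; rewrite mcoeffD mcoeffZ scalerDl scalerA.
Qed.
HB.instance Definition _ :=
  GRing.isLinear.Build _ _ _ _ boundary boundary_is_linear.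

Definition chain_of (K : complex) (p : nat) (u : chain) :=
  forall s, s \in msupp u -> simplices K s /\ #|` s| = p.+1.

Definition cycle_pred (K : complex) (p : nat) : {pred chain} :=
  [pred u | `[< chain_of K p u >] && (boundary u == 0)].

Lemma chain_of_closed K p a (u v : chain) : chain_of K p u -> chain_of K p v ->
  chain_of K p (a *: u + v).
Proof.
move=> uK vK s /(fsubsetP (msuppD_le _ _)); rewrite in_fsetU => /orP[|/vK//].
by move=> /(fsubsetP (msuppZ_le _ _)) /uK.
Qed.

Lemma chain_of0 K p : chain_of K p 0.
Proof. by move=> s; rewrite msupp0 in_fset0. Qed.

Lemma cycle_submod_closed K p : submod_closed (cycle_pred K p).
Proof.
split; first by rewrite inE linear0 eqxx andbT; apply/asboolP/chain_of0.
move=> a u v; rewrite !inE => /andP[/asboolP uK /eqP u0] /andP[/asboolP vK /eqP v0].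
apply/andP; split; first by apply/asboolP/chain_of_closed.
by rewrite linearP/= u0 v0 scaler0 addr0.
Qed.
HB.instance Definition _ K p :=
  GRing.isSubmodClosed.Build _ _ (cycle_pred K p) (@cycle_submod_closed K p).

Definition cycle K p := {u : chain | u \in cycle_pred K p}.
HB.instance Definition _ K p := SubChoice.on (cycle K p).
HB.instance Definition _ K p := [SubChoice_isSubLmodule of cycle K p by <:].

(* As the boundary of a boundary is zero, these are all the elements of the
   image of the boundary map on [(p + 1)]-chains. *)
Definition is_boundary (K : complex) p : {pred cycle K p} :=
  [pred z | `[< exists2 w, chain_of K p.+1 w & boundary w = val z >]].

Lemma boundary_submod_closed K p : submod_closed (@is_boundary K p).
Proof.
split.
  by rewrite inE; exists 0; rewrite ?linear0//; exact: chain_of0.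
move=> a x y; rewrite !inE => -[u uK ux] [v vK vy].
exists (a *: u + v); first exact: chain_of_closed.
by rewrite !linearP/= ux vy.
Qed.
HB.instance Definition _ K p :=
  GRing.isSubmodClosed.Build _ _ (@is_boundary K p) (@boundary_submod_closed K p).

Definition homology (K : complex) p : lmodType 'F_2 := lquot (@is_boundary K p).

Section Functoriality.
Context (K L : complex) (KL : (simplices K `<=` simplices L)%classic) (p : nat).
Local Open Scope quotient_scope.

Lemma cycle_incl (z : cycle K p) : val z \in cycle_pred L p.
Proof.
have := valP z; rewrite !inE => /andP[/asboolP zK ->]; rewrite andbT.
by apply/asboolP => s /zK[/KL].
Qed.

Definition incl_cycle (z : cycle K p) : cycle L p := Sub (val z) (cycle_incl z).

Definition homology_map (x : homology K p) : homology L p :=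
  \pi_(homology L p) (incl_cycle (repr x)).

Lemma homology_map_pi (z : cycle K p) :
  homology_map (\pi_(homology K p) z) = \pi_(homology L p) (incl_cycle z).
Proof.
apply/lquot_eqP.
have : repr (\pi_(homology K p) z) - z \in (@is_boundary K p : {pred _}).
  by apply/lquot_eqP; rewrite reprK.
rewrite !inE => -[w wK wz]; exists w; last by rewrite wz.
by move=> s /wK[/KL].
Qed.

Lemma homology_map_linear : linear homology_map.
Proof.
move=> a x y; rewrite -{1}[x]reprK -{1}[y]reprK -pi_lquot_linear.
rewrite homology_map_pi /homology_map -pi_lquot_linear.
by congr (\pi_(homology L p) _); exact: val_inj.
Qed.
HB.instance Definition _ :=
  GRing.isLinear.Build _ _ _ _ homology_map homology_map_linear.
End Functoriality.
End Homology.

Arguments homology_map {V K L} KL p x.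

Section Geometry.
Context (R : realType) (d : nat).
Local Notation E := 'rV[R]_d.
Implicit Types (X Y Z A : set E).

(* The norm that the library puts on ['rV[R]_d] is the sup norm, hence this
   explicit Euclidean distance; the topology (used for [compact]) is the same. *)
Definition dist2 (x y : E) : R := Num.sqrt (\sum_i (x 0 i - y 0 i) ^+ 2).

Definition set_dist Y Z : \bar R :=
  ereal_inf [set (dist2 yz.1 yz.2)%:E | yz in Y `*` Z].

Definition diam X : \bar R :=
  ereal_sup [set (dist2 xy.1 xy.2)%:E | xy in X `*` X].

Definition eps_connected (e : R) X :=
  ~ exists Y Z, [/\ Y !=set0, Z !=set0, X = Y `|` Z & (e%:E < set_dist Y Z)%E].

Definition eps_component X (e : R) Y :=
  [/\ Y `<=` X, Y !=set0, eps_connected e Y & (e%:E < set_dist Y (X `\` Y))%E].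

Definition num_components X (e : R) : \bar R := counting (eps_component X e).

(* [delta A 1] is the diameter, which is finite when [A] is compact; the formula
   with the number of components is only meant for [2 <= k]. *)
Definition delta A (k : nat) : R :=
  if k == 1%N then fine (diam A)
  else inf [set e | 0 < e /\ (num_components A e <= k.-1%:R%:E)%E].

Definition closed_dball (x : E) (r : R) : set E := [set y | dist2 x y <= r].

Definition cech_simplices X (e : R) : set {fset E} :=
  [set s | [/\ 0 <= e, s != fset0, [set` s] `<=` X &
    \bigcap_(x in [set` s]) closed_dball x (e / 2) !=set0]].

Lemma cech_neq0 X e s : cech_simplices X e s -> s != fset0.
Proof. by case. Qed.

Lemma cech_face X e s t : cech_simplices X e s -> (t `<=` s)%fset ->
  t != fset0 -> cech_simplices X e t.
Proof.
move=> [e0 s0 sX [y ys]] /fsubsetP ts t0; split => //.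
  by move=> x /ts /sX.
by exists y => x /ts; exact: ys.
Qed.

Definition cech X e : complex E := Complex (@cech_neq0 X e) (@cech_face X e).

Lemma cech_incl X s t : s <= t ->
  (simplices (cech X s) `<=` simplices (cech X t))%classic.
Proof.
move=> st u [s0 u0 uX [y ys]]; split => //; first exact: le_trans st.
by exists y => x /ys /le_trans; apply; rewrite ler_pM2r.
Qed.

(* Rank of the map [M^(s, t)] of the persistence module [H_p]; the value for
   [t < s], where there is no such map, is irrelevant. *)
Definition cech_rank (p : nat) X (s t : R) : \bar R :=
  if pselect (s <= t) is left st then rank R (homology_map (@cech_incl X s t st) p)
  else 0%E.

(* The class in degree 0 that never dies is given the death time [D]. *)
Definition kill_essential (D : R) (r : R -> R -> \bar R) (s t : R) : \bar R :=
  if [&& 0 <= s, s <= t & D <= t] then (r s t - 1)%E else r s t.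

(* [r s t] is the rank of [M^(s, t)]; the levels [n] start at 1. The supremum
   of the empty set is 0. *)
Definition landscape (r : R -> R -> \bar R) (n : nat) (t : R) : R :=
  sup [set m | 0 <= m /\ (n%:R%:E <= r (t - m)%R (t + m)%R)%E].

Definition H0_landscape A : nat -> R -> R :=
  landscape (kill_essential (fine (diam A)) (cech_rank 0 A)).

Definition similitude (c : R) (psi : E -> E) :=
  forall x y, dist2 (psi x) (psi y) = c * dist2 x y.

Definition invariant_set (N : nat) (psi : 'I_N -> E -> E) A :=
  [/\ A !=set0, compact A & A = \bigcup_(i in [set: 'I_N]) (psi i @` A)].

Definition well_separated (N : nat) (psi : 'I_N -> E -> E) A : Prop :=
  (\big[maxe/-oo]_(j < N) diam (psi j @` A) <=
   \big[mine/+oo]_(jk : 'I_N * 'I_N | jk.1 != jk.2)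
     set_dist (psi jk.1 @` A) (psi jk.2 @` A))%E.

End Geometry.

Section Linfty.
Context (R : realType).
Local Notation mu := (@lebesgue_measure R).
Local Notation RR := (measurableTypeR R).
Local Notation ess_class := {mfun_ mu, RR >-> RR}.

(* Sequences, with bounded essential suprema, of classes of measurable functions
   modulo equality almost everywhere. The sequences are indexed by 1, 2, ...
   in the mathematics and from 0 here: [f n] stands for the component [n + 1]. *)
Record Linfty := MkLinfty {
  Linfty_seq :> nat -> ess_class;
  Linfty_bounded :
    (ereal_sup (range (fun n => 'N[mu]_+oo[EFin \o (Linfty_seq n : R -> R)])) < +oo)%E
}.

Lemma Linfty_inj (f g : Linfty) : (forall n, f n = g n) -> f = g.
Proof.
case: f g => [f fb] [g gb] /= fg; have {}fg : f = g by exact/funext.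
by rewrite fg in fb *; congr MkLinfty; exact: Prop_irrelevance.
Qed.

Definition hat (b : R) : RR -> RR := fun t => Num.max 0 (Num.min t (b - t)).

Definition rescale (c : R) (g : RR -> RR) : RR -> RR := fun x => c * g (c^-1 * x).

Lemma measurable_dilation (a : R) : measurable_fun [set: RR] (fun x : RR => a * x : RR).
Proof. by apply: continuous_measurable_fun => x; exact: mulrl_continuous. Qed.

Lemma measurable_hat b : measurable_fun [set: RR] (hat b : RR -> RR).
Proof.
apply: continuous_measurable_fun => x.
apply: (@continuous_max _ _ (cst 0) (fun t : R => Num.min t (b - t))).
  exact: cvg_cst.
apply: (@continuous_min _ _ idfun (fun t : R => b - t)); first exact: cvg_id.
by apply: cvgB; [exact: cvg_cst|exact: cvg_id].
Qed.
HB.instance Definition _ b :=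
  isMeasurableFun.Build _ _ RR RR (hat b) (measurable_hat b).

Lemma measurable_rescale c (g : {mfun RR >-> RR}) : measurable_fun setT (rescale c g).
Proof.
apply: (@measurable_funM _ RR _ _ (cst c)) => //.
by apply: (measurableT_comp (f := g)).
Qed.
HB.instance Definition _ c (g : {mfun RR >-> RR}) :=
  isMeasurableFun.Build _ _ RR RR (rescale c g) (measurable_rescale c g).

Lemma preimage_dilation_measure (a : R) (B : set RR) : a != 0 -> measurable B ->
  mu B = (`|a|%:E * mu ((fun x => (a * x)%R) @^-1` B))%E.
Proof.
move=> a0 mB.
have mf : measurable_fun [set: RR] (fun x : RR => a * x) by exact: measurable_dilation.
pose nu := mscale (NngNum (normr_ge0 a)) (pushforward mu (fun x : RR => a * x : RR)).
rewrite -[RHS]/(nu mf B); apply: lebesgue_measure_unique => // _ [[u v]] _ <-.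
change (mu `]u, v] = (`|a|%:E * mu ((fun x : R => (a * x)%R) @^-1` `]u, v]))%E).
have [a_lt0|a_gt0|/eqP] := ltgtP a 0; last by rewrite (negbTE a0).
- have -> : (fun x => a * x) @^-1` `]u, v] = `[a^-1 * v, a^-1 * u[%classic.
    apply/seteqP; split => x /=; rewrite !in_itv/=.
      by rewrite ler_ndivrMl// ltr_ndivlMl// andbC.
    by rewrite ler_ndivrMl// ltr_ndivlMl// andbC.
  rewrite !lebesgue_measure_itv/= !lte_fin ltr_nM2l ?invr_lt0//.
  case: ifPn => _; last by rewrite mule0.
  by rewrite -!EFinB -EFinM ltr0_norm// -mulrBr mulrA mulNr mulfV// mulN1r opprB.
- have -> : (fun x => a * x) @^-1` `]u, v] = `]a^-1 * u, a^-1 * v]%classic.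
    apply/seteqP; split => x /=; rewrite !in_itv/=.
      by rewrite ler_pdivlMl// ltr_pdivrMl.
    by rewrite ler_pdivlMl// ltr_pdivrMl.
  rewrite !lebesgue_measure_itv/= !lte_fin ltr_pM2l ?invr_gt0//.
  case: ifPn => _; last by rewrite mule0.
  by rewrite -!EFinB -EFinM gtr0_norm// -mulrBr mulrA mulfV// mul1r.
Qed.

Lemma ae_dilation (a : R) (P : set R) : a != 0 ->
  {ae mu, forall x, P x} -> {ae mu, forall x, P (a * x)}.
Proof.
move=> a0 [B [mB B0 PB]]; exists ((fun x => a * x) @^-1` B); split.
- by rewrite -[X in measurable X]setTI; exact: (measurable_dilation a).
- apply/eqP; have /esym/eqP := preimage_dilation_measure a0 mB.
  by rewrite B0 mule_eq0 eqe normr_eq0 (negbTE a0).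
- by move=> x /= nP; exact: PB.
Qed.

Lemma rescale_ae c (f g : R -> R) : {ae mu, forall x, f x = g x} ->
  {ae mu, forall x, rescale c f x = rescale c g x}.
Proof.
move=> fg; have [->|c0] := eqVneq c 0.
  by apply: aeW => x; rewrite /rescale !mul0r.
have := ae_dilation (invr_neq0 c0) fg.
by apply: (@filterS _ _ (ae_filter_ringOfSetsType mu)) => x; rewrite /rescale => ->.
Qed.

Local Open Scope quotient_scope.

Definition ess_pi (f : {mfun RR >-> RR}) : ess_class := \pi_ess_class f.

Lemma ess_piK (f : {mfun RR >-> RR}) :
  {ae mu, forall x, (ess_pi f : RR -> RR) x = f x}.
Proof.
have /eqP : ess_pi f = \pi_ess_class (repr (ess_pi f)) by rewrite reprK.
rewrite eqmodE => /asboolP.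
by apply: (@filterS _ _ (ae_filter_ringOfSetsType mu)) => x /(_ I) ->.
Qed.

Lemma ess_pi_eq (f g : {mfun RR >-> RR}) :
  {ae mu, forall x, f x = g x} -> ess_pi f = ess_pi g.
Proof.
move=> fg; apply/eqP; rewrite eqmodE; apply/asboolP.
by apply: (@filterS _ _ (ae_filter_ringOfSetsType mu)) fg.
Qed.

(* With the index shift: the components [1 <= j <= N] of the image are the hat
   functions of the [b j], and the component [k * N + l], for [1 <= k] and
   [1 <= l <= N], is the rescaled component [k + 1] of [g], that is, [g k]
   with [k = (k * N + l - 1) %/ N]; see [landscape_op_head/tail] below. *)
Definition landscape_op_seq (N : nat) (c : R) (b : nat -> R) (g : Linfty)
    (n : nat) : ess_class :=
  if (n < N)%N then ess_pi (hat (b n.+1))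
  else ess_pi (rescale c (repr (g (n %/ N)%N))).

Lemma Lnorm_ley (f : R -> R) (M : R) : {ae mu, forall x, `|f x| <= M} -> 0 <= M ->
  ('N[mu]_+oo[EFin \o f] <= M%:E)%E.
Proof.
move=> fM M0; rewrite unlock; case: ifPn => _; last by rewrite lee_fin.
apply/ess_supP.
by apply: (@filterS _ _ (ae_filter_ringOfSetsType mu)) fM => x; rewrite /= lee_fin.
Qed.

Lemma Lnorm_yP (f : R -> R) (M : R) : ('N[mu]_+oo[EFin \o f] <= M%:E)%E ->
  {ae mu, forall x, `|f x| <= M}.
Proof.
rewrite unlock; case: ifPn => [_ /ess_supP|].
  by apply: (@filterS _ _ (ae_filter_ringOfSetsType mu)) => x; rewrite /= lee_fin.
suff -> : (0 < mu [set: R])%E by [].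
have -> : [set: R] = [set` (`]-oo, +oo[ : interval R)] by rewrite set_itvE.
by rewrite lebesgue_measure_itv/= addye// ltry.
Qed.

Lemma hat_le (b t : R) : `|hat b t| <= `|b|.
Proof.
rewrite /hat ger0_norm ?le_max ?lexx// ge_max normr_ge0 ge_min /=.
have := ler_norm b; have [//|tb] := leP t `|b|; rewrite lerBlDr.
by move=> /le_trans->//; rewrite lerDl (le_trans _ (ltW tb)).
Qed.

Lemma landscape_op_bounded N c b g : (ereal_sup (range (fun n =>
  'N[mu]_+oo[EFin \o (landscape_op_seq N c b g n : R -> R)])) < +oo)%E.
Proof.
have [M gM] : exists M : R, forall n, {ae mu, forall x, `|(g n : R -> R) x| <= M}.
  have := Linfty_bounded g; set S := ereal_sup _ => Sy.
  exists (fine S) => n; apply: Lnorm_yP; rewrite fineK.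
    by apply: ereal_sup_ubound; exists n.
  rewrite ge0_fin_numE//.
  by apply: le_trans (Lnorm_ge0 mu +oo%E _) (ereal_sup_ubound _); exists 0%N.
pose K := \sum_(n < N) `|b n.+1| + `|c| * `|M|.
have S0 : 0 <= \sum_(n < N) `|b n.+1| by exact: sumr_ge0.
have cM0 : 0 <= `|c| * `|M| by rewrite mulr_ge0.
apply: (@le_lt_trans _ _ K%:E); last exact: ltry.
apply: ub_ereal_sup => _ [n _ <-]; apply: Lnorm_ley; last exact: addr_ge0.
rewrite /landscape_op_seq; case: ifPn => nN.
  apply: (@filterS _ _ (ae_filter_ringOfSetsType mu)) (ess_piK (hat (b n.+1))) => x ->.
  rewrite (le_trans (hat_le _ _))// /K (bigD1 (Ordinal nN))//= -addrA lerDl.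
  by rewrite addr_ge0// sumr_ge0.
have gn : {ae mu, forall x, `|rescale c (repr (g (n %/ N)%N)) x| <= `|c| * `|M|}.
  have [->|c0] := eqVneq c 0.
    by apply: aeW => x; rewrite /rescale mul0r !normr0 mul0r.
  apply: (@filterS _ _ (ae_filter_ringOfSetsType mu))
    (ae_dilation (invr_neq0 c0) (gM (n %/ N)%N)).
  by move=> x xM; rewrite /rescale normrM ler_wpM2l// (le_trans xM)// ler_norm.
apply: (@filterS2 _ _ (ae_filter_ringOfSetsType mu))
  (ess_piK (rescale c (repr (g (n %/ N)%N)))) gn => x -> /le_trans; apply.
by rewrite /K lerDr.
Qed.

Definition landscape_op N c b g : Linfty :=
  MkLinfty (landscape_op_bounded N c b g).

Lemma landscape_op_head N c b g n : (n < N)%N ->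
  landscape_op N c b g n = ess_pi (hat (b n.+1)).
Proof. by move=> nN; rewrite /= /landscape_op_seq nN. Qed.

Lemma landscape_op_tail N c b (g : Linfty) k l (u : {mfun RR >-> RR}) :
  (0 < k)%N -> (l < N)%N -> {ae mu, forall x, (g k : RR -> RR) x = u x} ->
  landscape_op N c b g (k * N + l)%N = ess_pi (rescale c u).
Proof.
move=> k0 lN gu; rewrite /= /landscape_op_seq ltnNge.
rewrite (leq_trans (leq_pmull N k0) (leq_addr l _))/=.
rewrite divnMDl ?(leq_trans _ lN)// divn_small// addn0.
by apply: ess_pi_eq; exact: rescale_ae.
Qed.

(* The sequence of functions [u 1, u 2, ...] has class [f]. *)
Definition represents (f : Linfty) (u : nat -> R -> R) :=
  forall n, {ae mu, forall x, (f n : RR -> RR) x = u n.+1 x}.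

End Linfty.

(* Main.v *)
(* The rank of [M^(s, t)] on [H_0] is the number of components of the graph on
   [A] joining points at distance at most [t], so the [n]-th landscape function
   is a hat function whose width is the [n]-th death time, the supremum of the
   [t] at which this graph has at least [n] components. For [t > 0], by
   compactness, these components are the [t]-components of [A], which gives the
   first [N] widths. If the graph at scale [t] has more than [N * k] components,
   then by the pigeonhole principle one of the pieces [psi_i A] contains points
   of [k + 1] of them, and these come from distinct components of [A] at scale
   [t / c]. Conversely, [k + 1 >= 2] components of [A] at scale [t / c] force
   [t < c * diam A], and separation then prevents edges between different
   pieces, so that there are [N * (k + 1)] components at scale [t]. Hence the
   death times [N * k + 1], ..., [N * k + N] are all [c] times the [k + 1]-st. *)

Require Import Defs.
From HB Require Import structures.
From mathcomp Require Import all_boot all_order all_algebra finmap.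
From mathcomp.multinomials Require monalg. Import -(notations) monalg.
From mathcomp Require Import all_classical all_reals all_analysis.
From mathcomp Require Import ring lra.

Set Implicit Arguments.
Unset Strict Implicit.
Unset Printing Implicit Defensive.

Import Order.TTheory GRing.Theory Num.Theory.
Import numFieldNormedType.Exports.

Local Open Scope classical_set_scope.
Local Open Scope ring_scope.

(** * Rank on [H_0] *)

Section Rank.
Context (F : fieldType).

(** Coefficients on the subfamily are pushed forward along [h] by summing over fibres, which are
    empty or singletons. *)
Lemma lin_indep_comp (W : lmodType F) m n (w : 'I_n -> W) (h : 'I_m -> 'I_n) :
  injective h -> lin_indep w -> lin_indep (w \o h).
Proof.
move=> hI wI a a0.
pose b j := \sum_(i | h i == j) a i.
have bh i : b (h i) = a i.
  rewrite /b (big_pred1 i)// => k /=.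
  by apply/eqP/eqP => [/hI|->].
move=> i; rewrite -bh; apply: wI.
rewrite -[RHS]a0 (partition_big h predT)//=; apply: eq_bigr => j _.
by rewrite /b scaler_suml; apply: eq_bigr => k /eqP ->.
Qed.

Lemma rank_geP (R : realType) (U W : lmodType F) (f : {linear U -> W}) n :
  (n%:R%:E <= rank R f)%E <->
  exists v : 'I_n -> U, lin_indep (fun i => f (v i)).
Proof.
split=> [|[v vI]]; last by apply: ereal_sup_ubound; exists n => //; exists v.
case: n => [_|n le_n]; first by exists (fun=> 0) => a _ [].
(* A strict inequality below the supremum yields an actual independent family, of size [m > n],
   which is then truncated. *)
have : (n%:R%:E < rank R f)%E.
  by apply: lt_le_trans le_n; rewrite lte_fin ltr_nat.
move=> /ereal_sup_gt[_ [m [v vI] <-]]; rewrite lte_fin ltr_nat => nm.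
exists (v \o widen_ord nm).
by apply: (lin_indep_comp (h := widen_ord nm) _ vI) => i j /(congr1 val) /= /val_inj.
Qed.

(** Meant for [w i] congruent to the combination of the [e j] with coefficients [M i j]: a left
    kernel vector of [M] cancels the main parts, and only the error terms remain. *)
Lemma kernel_combination (W : lmodType F) m n (r : 'rV[F]_n) (M : 'I_n -> 'I_m -> F)
    (w : 'I_n -> W) (e : 'I_m -> W) :
  r *m (\matrix_(i, j) M i j) = 0 ->
  \sum_i r 0 i *: (w i - \sum_j M i j *: e j) = \sum_i r 0 i *: w i.
Proof.
move=> rM; under eq_bigr do rewrite scalerBr.
rewrite sumrB [X in _ - X](_ : _ = 0) ?subr0//.
under eq_bigr do rewrite scaler_sumr.
rewrite exchange_big big1//= => j _.
under eq_bigr do rewrite scalerA.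
rewrite -scaler_suml; have /rowP/(_ j) := rM; rewrite !mxE => rMj.
rewrite (_ : \sum_i _ = 0) ?scale0r// -[RHS]rMj.
by apply: eq_bigr => i _; rewrite [X in _ = _ * X]mxE.
Qed.

End Rank.

Section Lquot.
Context (F : nzRingType) (V : lmodType F) (S : submodClosed V).
Local Open Scope quotient_scope.

Lemma pi_lquot0 : \pi_(lquot S) 0 = 0.
Proof. by rewrite -(scale0r (0 : V)) pi_lquotZ; exact: (scale0r (\pi_(lquot S) 0)). Qed.

Lemma pi_lquot_sum n (w : 'I_n -> V) :
  \pi_(lquot S) (\sum_i w i) = \sum_i \pi_(lquot S) (w i).
Proof. by apply: big_morph; [exact: pi_lquotD|exact: pi_lquot0]. Qed.

End Lquot.

(** * Degree-0 homology and connected components *)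

Section H0.
Context (V : choiceType).
Implicit Types (K L : complex V) (x y : V) (u : chain V).
Local Open Scope fset_scope.
Local Open Scope ring_scope.
Local Open Scope quotient_scope.

(* Impredicative form of the existence of an edge path from [x] to [y]. *)
Definition connected_in K x y := forall U : set V,
  (forall a b, U a -> simplices K [fset a; b] -> U b) -> U x -> U y.

(* At least [n] components of [L] contain vertices of [K]. *)
Definition num_components_ge K L n := exists v : 'I_n -> V,
  (forall i, simplices K [fset v i]) /\
  (forall i j, connected_in L (v i) (v j) -> i = j).

Lemma connected_in_refl K x : connected_in K x x.
Proof. by []. Qed.

Lemma connected_in_trans K y x z :
  connected_in K x y -> connected_in K y z -> connected_in K x z.
Proof. by move=> xy yz U US /(xy _ US) /(yz _ US). Qed.

Lemma connected_in_sym K x y : connected_in K x y -> connected_in K y x.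
Proof.
move=> xy U US Uy; apply: contrapT => nUx; apply: (xy (~` U)) Uy => //.
by move=> a b nUa; rewrite fsetUC => ab Ub; exact/nUa/(US _ _ Ub ab).
Qed.

Lemma connected_in_edge K a b : simplices K [fset a; b] -> connected_in K a b.
Proof. by move=> ab U US Ua; exact: US ab. Qed.

Lemma num_components_ge_le K L m n : (m <= n)%N ->
  num_components_ge K L n -> num_components_ge K L m.
Proof.
move=> mn [v [vK vI]]; exists (v \o widen_ord mn); split=> [i|i j /vI] /=.
  exact: vK.
by move=> /(congr1 val) /= /val_inj.
Qed.

Definition vertex_chain x : chain V := mkmalgU [fset x] 1.

(** Null-homology on the level of chains, which keeps later arguments out of the quotient. *)
Definition bounds L u := exists2 w, chain_of L 1 w & boundary w = u.

Lemma bounds_linear L a u v : bounds L u -> bounds L v -> bounds L (a *: u + v).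
Proof.
move=> [w wL <-] [w' w'L <-]; exists (a *: w + w'); last by rewrite linearP.
exact: chain_of_closed.
Qed.

Lemma bounds0 L : bounds L 0.
Proof. by exists 0; [exact: chain_of0|rewrite linear0]. Qed.

Lemma boundary_chain0 L u : chain_of L 0 u -> boundary u = 0.
Proof.
move=> uL; rewrite /boundary big_seq big1// => s /uL[_ s1].
by rewrite /simplex_boundary s1 leqnn scaler0.
Qed.

Lemma cycle0P L u : reflect (chain_of L 0 u) (u \in cycle_pred L 0).
Proof.
rewrite inE; apply: (iffP andP) => [[/asboolP]//|uL].
by split; [apply/asboolP|rewrite (boundary_chain0 uL)].
Qed.

Lemma msupp_simplex (s : {fset V}) : msupp (mkmalgU s 1 : chain V) = [fset s].
Proof. by rewrite msuppU oner_eq0. Qed.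

Lemma boundary_simplex (s : {fset V}) :
  boundary (mkmalgU s 1) = simplex_boundary s.
Proof. by rewrite /boundary msupp_simplex big_seq_fset1 mcoeffUU scale1r. Qed.

Lemma simplex_boundary_pair a b : a != b ->
  simplex_boundary [fset a; b] = vertex_chain a + vertex_chain b.
Proof.
move=> ab; rewrite /simplex_boundary cardfs2 ab /=.
rewrite big_fsetU1 ?inE//= big_seq_fset1 addrC.
have E (x y : V) : x != y -> [fset x; y] `\ x = [fset y].
  move=> xy; apply/fsetP => z; rewrite !inE.
  by case: (eqVneq z x) => [->|]; rewrite // (negbTE xy).
by rewrite (E _ _ ab) fsetUC (E b a) 1?eq_sym.
Qed.

Lemma oppr_F2 (W : lmodType 'F_2) (w : W) : - w = w.
Proof. by rewrite -scaleN1r (_ : -1 = 1) ?scale1r//; exact/val_inj. Qed.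

(** The set of [z] such that [x - z] bounds is closed along edges, because modulo 2 the boundary of
    an edge [ab] is [a - b]. *)
Lemma connected_bounds L x y :
  connected_in L x y -> bounds L (vertex_chain x - vertex_chain y).
Proof.
move=> /(_ (fun z => bounds L (vertex_chain x - vertex_chain z))); apply.
  2: by rewrite subrr; exact: bounds0.
move=> a b xa ab; have [->//|aNb] := eqVneq b a.
have : bounds L (vertex_chain a - vertex_chain b).
  exists (mkmalgU [fset a; b] 1).
    move=> s; rewrite msupp_simplex inE => /eqP ->; split=> //.
    by rewrite cardfs2 eq_sym aNb.
  by rewrite boundary_simplex simplex_boundary_pair 1?eq_sym// oppr_F2.
move=> /(bounds_linear 1 xa).
by rewrite scale1r addrA subrK.
Qed.

Lemma homology_map_pi_eq0 K L (KL : (simplices K `<=` simplices L)%classic)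
    (z : Defs.cycle K 0) :
  homology_map KL 0 (\pi_(homology K 0) z) = 0 <-> bounds L (val z).
Proof.
rewrite homology_map_pi -(pi_lquot0 (@is_boundary V L 0)).
split=> [/lquot_eqP|zB]; last apply/lquot_eqP.
  by rewrite subr0 inE => -[w wL]; exists w.
by rewrite subr0 inE.
Qed.

Lemma lin_indep_homologyP n K L (KL : (simplices K `<=` simplices L)%classic)
    (z : 'I_n -> Defs.cycle K 0) :
  lin_indep (fun i => homology_map KL 0 (\pi_(homology K 0) (z i))) <->
  forall a, bounds L (\sum_i a i *: val (z i)) -> forall i, a i = 0.
Proof.
suff E a : \sum_i a i *: homology_map KL 0 (\pi_(homology K 0) (z i)) = 0 <->
    bounds L (\sum_i a i *: val (z i)).
  by split=> H a /E /H.
have -> : \sum_i a i *: homology_map KL 0 (\pi_(homology K 0) (z i)) =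
    homology_map KL 0 (\pi_(homology K 0) (\sum_i a i *: z i)).
  rewrite pi_lquot_sum linear_sum; apply: eq_bigr => i _.
  by rewrite pi_lquotZ linearZ.
rewrite homology_map_pi_eq0.
suff -> : val (\sum_i a i *: z i) = \sum_i a i *: val (z i) by [].
by rewrite linear_sum; apply: eq_bigr => i _; rewrite linearZ.
Qed.

Lemma cardfs2_exists (s : {fset V}) : #|` s| = 2%N ->
  exists a b, a != b /\ s = [fset a; b].
Proof.
move=> s2; have /fset0Pn[a sa] : s != fset0 by rewrite -cardfs_gt0 s2.
move: s2; rewrite (cardfsD1 a) sa => -[/eqP/cardfs1P[b sb]].
exists a, b; split; last by rewrite -(fsetD1K sa) sb.
have : b \in s `\ a by rewrite sb inE.
by rewrite !inE eq_sym => /andP[].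
Qed.

(* Applied to indicator functions of components, this linear form detects
   independence in [H_0]. *)
Definition chain_eval (g : {fset V} -> 'F_2) u : 'F_2 :=
  \sum_(s <- msupp u) mcoeff s u * g s.

Lemma chain_eval_linear g : linear_for *%R (chain_eval g).
Proof.
have E (d : {fset {fset V}}) u : msupp u `<=` d ->
    chain_eval g u = \sum_(s <- d) mcoeff s u * g s.
  move=> ud; rewrite /chain_eval (big_fset_incl _ ud)// => s _ su.
  by rewrite (mcoeff_outdom su) mul0r.
move=> a u v; pose d := msupp (a *: u + v) `|` msupp u `|` msupp v.
rewrite (E d) ?(E d u) ?(E d v) ?mulr_sumr -?big_split/=; last 3 first.
- by rewrite /d fsubsetUr.
- by rewrite /d -fsetUA fsubsetU// fsubsetUl orbT.
- by rewrite /d -fsetUA fsubsetUl.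
by apply: eq_bigr => s _; rewrite mcoeffD mcoeffZ mulrDl mulrA.
Qed.
HB.instance Definition _ g :=
  GRing.isLinear.Build _ _ _ _ (chain_eval g) (chain_eval_linear g).

Lemma chain_eval_simplex g s : chain_eval g (mkmalgU s 1) = g s.
Proof. by rewrite /chain_eval msupp_simplex big_seq_fset1 mcoeffUU mul1r. Qed.

(** A function constant along edges is a cocycle: each edge contributes twice the same value, which
    vanishes modulo 2. *)
Lemma chain_eval_bounds g L u :
  (forall a b, simplices L [fset a; b] -> g [fset a] = g [fset b]) ->
  bounds L u -> chain_eval g u = 0.
Proof.
move=> gL [w wL <-]; rewrite /boundary linear_sum big_seq big1//= => s sw.
rewrite linearZ/=; have [sL s2] := wL s sw.
have [a [b [ab sab]]] := cardfs2_exists s2.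
rewrite sab simplex_boundary_pair// linearD/= !chain_eval_simplex.
rewrite (gL a b) -?sab//.
by rewrite -mulr2n -mulr_natr (_ : 2%:R = 0) ?mulr0//; exact: val_inj.
Qed.

(** Vertices in distinct components are independent, since indicator functions of components tell
    them apart. Conversely, representatives of the components of [L] met by [K] span the image, so
    there are at least as many of them as independent classes. *)
Lemma rank_H0_ge (R : realType) K L
    (KL : (simplices K `<=` simplices L)%classic) n :
  (n%:R%:E <= rank R (homology_map KL 0))%E <-> num_components_ge K L n.
Proof.
rewrite rank_geP; split; last first.
  move=> [v [vK vI]].
  have pK i : vertex_chain (v i) \in cycle_pred K 0.
    by apply/cycle0P => s; rewrite msupp_simplex inE => /eqP ->; rewrite cardfs1.
  exists (fun i => \pi_(homology K 0) (Sub (vertex_chain (v i)) (pK i))).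
  apply/lin_indep_homologyP => a; rewrite /= => aB i.
  (* Evaluating a bounding combination against this indicator isolates the coefficient [a i]. *)
  pose g (s : {fset V}) : 'F_2 :=
    `[< exists2 x, s = [fset x] & connected_in L (v i) x >]%:R.
  have gE x : g [fset x] = `[< connected_in L (v i) x >]%:R.
    congr (_ %:R); congr nat_of_bool; apply/asboolP/asboolP=> [[y]|]; last by exists x.
    by move=> /fset1_inj ->.
  have /= := @chain_eval_bounds g L _ _ aB.
  rewrite linear_sum/= (bigD1 i)//= big1 ?addr0 => [|j ji].
    rewrite linearZ/= chain_eval_simplex gE asboolT ?mulr1; last exact: connected_in_refl.
    apply=> x y xy; rewrite !gE; congr (_ %:R); congr nat_of_bool.
    have {}xy := connected_in_edge xy.
    apply/asboolP/asboolP => vx; apply: connected_in_trans vx _ => //.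
    exact: connected_in_sym.
  rewrite linearZ/= chain_eval_simplex gE asboolF ?mulr0// => /vI ij.
  by rewrite ij eqxx in ji.
move=> [x xI]; apply: contrapT => nP.
have P0 : exists m, `[< num_components_ge K L m >].
  have v0 : 'I_0 -> V by case.
  by exists 0%N; apply/asboolP; exists v0; split=> -[].
have Pn m : `[< num_components_ge K L m >] -> (m <= n)%N.
  move=> /asboolP Pm; rewrite leqNgt; apply/negP => nm; apply: nP.
  exact: num_components_ge_le (ltnW nm) Pm.
have [m /asboolP Pm mP] := ex_maxnP P0 Pn.
have mn : (m < n)%N.
  by rewrite ltnNge; apply/negP => nm; apply: nP; exact: num_components_ge_le Pm.
have [v [vK vI]] := Pm.
(* Otherwise [y] could be added to the family, against the maximality of [m]. *)
have vT y : simplices K [fset y] -> exists j, connected_in L (v j) y.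
  move=> yK; apply: contrapT => /forallNP nv.
  suff Pm1 : num_components_ge K L m.+1 by have /asboolP/mP := Pm1; rewrite ltnn.
  exists (fun i => oapp v y (unlift ord0 i)); split.
    by move=> i; case: unliftP => [i'|] _ /=; [exact: vK|exact: yK].
  move=> i j; case: unliftP => [i'|] ->; case: unliftP => [j'|] -> //=.
  - by move=> /vI ->.
  - by move=> /nv.
  - by move=> /connected_in_sym /nv.
have uE u : chain_of K 0 u ->
    exists a : 'I_m -> 'F_2, bounds L (u - \sum_j a j *: vertex_chain (v j)).
  move=> uK; rewrite [u]monalgE big_seq.
  apply: (big_ind (fun u : chain V => exists a : 'I_m -> 'F_2,
    bounds L (u - \sum_j a j *: vertex_chain (v j)))).
  - exists (fun=> 0); rewrite big1 ?subrr; first exact: bounds0.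
    by move=> ? _; rewrite scale0r.
  - move=> u1 u2 [a1 b1] [a2 b2]; exists (fun j => a1 j + a2 j).
    have := bounds_linear 1 b1 b2; rewrite scale1r; congr bounds.
    rewrite addrACA -opprD -big_split/=; congr (_ - _).
    by apply: eq_bigr => j _; rewrite scalerDl.
  - move=> s /uK[sK /eqP/cardfs1P[y sy]].
    rewrite sy in sK *; have [j jy] := vT _ sK.
    set b := mcoeff _ u; exists (fun k => b * (k == j)%:R).
    have := bounds_linear b (connected_bounds (connected_in_sym jy)) (bounds0 L).
    rewrite addr0 scalerBr; congr (bounds _ (_ - _)).
      by apply/malgP => k; rewrite mcoeffZ [LHS]mulrC !mcoeffU mulrC mulrnAr mulr1.
    rewrite (bigD1 j)//= big1 => [|k kj].
      by rewrite eqxx mulr1 addr0.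
    by rewrite (negbTE kj) mulr0 scale0r.
have xK i : chain_of K 0 (val (repr (x i))) by apply/cycle0P/valP.
have [M MP] := choice (fun i => uE _ (xK i)).
(* With [n] rows and [m < n] columns, full row rank is absurd. Yet a left kernel vector of [M] gives
   a bounding combination of the cycles, so it vanishes by independence of their classes. *)
suff : row_free (\matrix_(i, j) M i j).
  by rewrite -row_leq_rank => /leq_trans/(_ (rank_leq_col _)); rewrite leqNgt mn.
have {}xI : lin_indep (fun i => homology_map KL 0 (\pi_(homology K 0) (repr (x i)))).
  by move=> a; under eq_bigr do rewrite reprK; exact: xI.
rewrite -kermx_eq0; apply/eqP/row_matrixP => k; rewrite row0.
set r := row k _; have rM : r *m (\matrix_(i, j) M i j) = 0.
  by rewrite /r -row_mul mulmx_ker row0.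
apply/rowP => i; rewrite [RHS]mxE; apply: (iffLR (lin_indep_homologyP _ _) xI (r 0)).
rewrite -(kernel_combination (fun i => val (repr (x i)))
  (fun j => vertex_chain (v j)) rM).
apply: (big_ind (bounds L)); first exact: bounds0.
  by move=> ? ? b1 b2; have := bounds_linear 1 b1 b2; rewrite scale1r.
by move=> j _; have := bounds_linear (r 0 j) (MP j) (bounds0 L); rewrite addr0.
Qed.

End H0.

Lemma connected_in_map (V W : choiceType) (K : complex V) (L : complex W)
    (g : V -> W) x y :
  (forall a b, simplices K [fset a; b]%fset -> connected_in L (g a) (g b)) ->
  connected_in K x y -> connected_in L (g x) (g y).
Proof.
move=> gKL /(_ (fun z => connected_in L (g x) (g z))); apply=> //.
by move=> a b xa /gKL; exact: connected_in_trans.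
Qed.

Lemma counting_geP (R : realType) (T : choiceType) (S : set T) n :
  (n%:R%:E <= counting S :> \bar R)%E <->
  exists2 v : 'I_n -> T, injective v & forall i, S (v i).
Proof.
split=> [nS|[v vI vS]]; last first.
  rewrite /counting; case: asboolP => [Sfin|_]; last exact: leey.
  rewrite lee_fin ler_nat.
  have <- : #|` [fset v i | i in 'I_n]%fset| = n.
    by rewrite card_imfset//= size_enum_ord.
  apply/fsubset_leq_card/fsubsetP => _ /imfsetP[i _ ->].
  by rewrite in_fset_set// inE.
(* An infinite [S], counted as [+oo], has finite subsets of arbitrarily large size. *)
have [B BS nB] : exists2 B : {fset T}, [set` B] `<=` S & (n <= #|` B|)%N.
  move: nS; rewrite /counting; case: asboolP => [Sfin|Sinf _].
    rewrite lee_fin ler_nat => nS; exists (fset_set S) => //.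
    by rewrite fset_setK.
  by have [B BS nB] := infinite_set_fset n Sinf; exists B.
exists (fun i : 'I_n => tnth (in_tuple B) (widen_ord nB i)); last first.
  by move=> i; apply: BS; exact: mem_tnth.
move=> i j; pose x0 := tnth (in_tuple B) (widen_ord nB i).
move=> /eqP; rewrite !(tnth_nth x0) nth_uniq//=.
- by move=> /eqP /val_inj.
- by rewrite (leq_trans (ltn_ord i)).
- by rewrite (leq_trans (ltn_ord j)).
Qed.

(** * Distances and components *)

Section Distance.
Context (R : realType) (d : nat).
Local Notation E := 'rV[R]_d.
Implicit Types (x y a b : E) (X Y Z A : set E) (t e : R).

Lemma dist2_ge0 x y : 0 <= dist2 x y.
Proof. exact: sqrtr_ge0. Qed.

Lemma dist2xx x : dist2 x x = 0.
Proof. by rewrite /dist2 big1 ?sqrtr0// => i _; rewrite subrr expr0n. Qed.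

Lemma dist2C x y : dist2 x y = dist2 y x.
Proof. by congr Num.sqrt; apply: eq_bigr => i _; rewrite -sqrrN opprB. Qed.

Lemma dist2_eq0 x y : dist2 x y = 0 -> x = y.
Proof.
move=> /eqP; rewrite sqrtr_eq0 => xy; apply/rowP => i; apply/eqP.
have : \sum_i (x 0 i - y 0 i) ^+ 2 == 0.
  by rewrite eq_le xy sumr_ge0// => j _; exact: sqr_ge0.
rewrite psumr_eq0; last by move=> j _; exact: sqr_ge0.
move=> /allP/(_ i (mem_index_enum _)) /=.
by rewrite sqrf_eq0 subr_eq0.
Qed.

Lemma dist2_le x y r : 0 <= r ->
  (dist2 x y <= r) = (\sum_i (x 0 i - y 0 i) ^+ 2 <= r ^+ 2).
Proof.
by move=> r0; rewrite -{1}(ger0_norm r0) -sqrtr_sqr ler_sqrt// sqr_ge0.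
Qed.

(** The triangle inequality for balls of equal radius follows coordinatewise from
    [(a - b)^2 <= 2 a^2 + 2 b^2]. *)
Lemma ball_meet_dist2 x y z r : dist2 x z <= r -> dist2 y z <= r ->
  dist2 x y <= 2 * r.
Proof.
move=> xz yz; have r0 : 0 <= r := le_trans (dist2_ge0 _ _) xz.
rewrite dist2_le ?mulr_ge0//; move: xz yz; rewrite !dist2_le// => xz yz.
apply: (@le_trans _ _ (2 * \sum_i (x 0 i - z 0 i) ^+ 2 +
    2 * \sum_i (y 0 i - z 0 i) ^+ 2)); last by nra.
rewrite !mulr_sumr -big_split/=; apply: ler_sum => i _.
have := sqr_ge0 (x 0 i - z 0 i + (y 0 i - z 0 i)); nra.
Qed.

Lemma dist2_mid x y : dist2 x (2^-1 *: (x + y)) = dist2 x y / 2.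
Proof.
rewrite /dist2 -[X in _ / X](@ger0_norm R)// -(sqrtr_sqr 2) -sqrtrV ?sqr_ge0//.
rewrite -sqrtrM ?sumr_ge0//; last by move=> i _; exact: sqr_ge0.
rewrite mulr_suml; congr Num.sqrt; apply: eq_bigr => i _; rewrite !mxE.
by field.
Qed.

(** When the distance is at most [t], the midpoint lies in both balls of radius [t / 2]. The case
    [a = b] gives the vertices. *)
Lemma cech_edge A t a b : simplices (cech A t) [fset a; b]%fset <->
  [/\ 0 <= t, A a, A b & dist2 a b <= t].
Proof.
split=> [[t0 _ sA [y ys]]|[t0 Aa Ab ab]].
  split=> //; [by apply: sA; rewrite /= !inE eqxx| |].
    by apply: sA; rewrite /= !inE eqxx orbT.
  rewrite (_ : t = 2 * (t / 2)); last by field.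
  by apply: (@ball_meet_dist2 _ _ y); apply: ys; rewrite /= !inE eqxx ?orbT.
split=> //.
- by apply/fset0Pn; exists a; rewrite !inE eqxx.
- by move=> x /=; rewrite !inE => /orP[] /eqP ->.
- exists (2^-1 *: (a + b)) => x /=; rewrite !inE /closed_dball/= => /orP[] /eqP ->.
    by rewrite dist2_mid ler_pM2r.
  by rewrite addrC dist2_mid dist2C ler_pM2r.
Qed.

Lemma cech_vertex A t a : simplices (cech A t) [fset a]%fset <-> 0 <= t /\ A a.
Proof.
rewrite -[X in simplices _ X](fsetUid [fset a]%fset) cech_edge dist2xx.
by split=> [[]|[]].
Qed.

Lemma set_dist_le Y Z y z : Y y -> Z z -> (set_dist Y Z <= (dist2 y z)%:E)%E.
Proof. by move=> Yy Zz; apply: ereal_inf_lbound; exists (y, z). Qed.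

Lemma diam_ge Y x y : Y x -> Y y -> ((dist2 x y)%:E <= diam Y)%E.
Proof. by move=> Yx Yy; apply: ereal_sup_ubound; exists (x, y). Qed.

Lemma dist2_continuous : continuous (fun p : E * E => dist2 p.1 p.2).
Proof.
move=> p; apply: (@continuous_comp _ _ _ _ (@Num.sqrt R)); last exact: sqrt_continuous.
apply: (cvg_big (op := +%R)) => [|i _]; first exact: add_continuous.
apply: (@continuous_comp _ _ _ (fun q : E * E => q.1 0 i - q.2 0 i)
  (fun x : R => x ^+ 2)).
  apply: (@cvgB _ R^o).
    by apply: (@continuous_comp _ _ _ fst (fun M : E => M 0 i));
      [exact: cvg_fst|exact: coord_continuous].
  by apply: (@continuous_comp _ _ _ snd (fun M : E => M 0 i));
      [exact: cvg_snd|exact: coord_continuous].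
exact: exprn_continuous.
Qed.

Lemma near_dist2 x e : 0 < e -> \forall y \near x, dist2 x y < e.
Proof.
move=> e0.
have [[P Q] /= [Px Qx] PQ] : \forall p \near (x, x), dist2 p.1 p.2 < e.
  by have /cvgr_lt := @dist2_continuous (x, x); apply; rewrite dist2xx.
apply: filterS Qx => y Qy; apply: (PQ (x, y)); split=> //=.
exact: nbhs_singleton.
Qed.

Lemma diam_attained A : A !=set0 -> compact A -> exists x y,
  [/\ A x, A y, fine (diam A) = dist2 x y &
      forall x' y', A x' -> A y' -> dist2 x' y' <= dist2 x y].
Proof.
move=> [a Aa] Ac.
have AA0 : A `*` A !=set0 by exists (a, a).
have cd := continuous_subspaceT dist2_continuous.
have [[x y] /set_mem[/= Ax Ay] xyM] := compact_EVT_max AA0 (compact_setX Ac Ac) (cd _).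
have {}xyM x' y' : A x' -> A y' -> dist2 x' y' <= dist2 x y.
  by move=> Ax' Ay'; apply: (xyM (x', y')); exact/mem_set.
exists x, y; split=> //.
suff -> : diam A = (dist2 x y)%:E by [].
apply/eqP; rewrite eq_le diam_ge// andbT; apply: ub_ereal_sup.
by move=> _ [[x' y'] [/= Ax' Ay'] <-]; rewrite lee_fin; exact: xyM.
Qed.

End Distance.

(** * Components of the graph at scale [t] and epsilon-components *)

Section Components.
Context (R : realType) (d : nat).
Local Notation E := 'rV[R]_d.
Implicit Types (x y a b : E) (X Y Z A U : set E) (t e : R).

(** A point of the closure of [U] lies in [A] and within [e] of a point of [U], hence in [U]; so [U]
    is closed. *)
Lemma compact_saturated A U e : compact A -> 0 < e -> U `<=` A ->
  (forall a b, U a -> A b -> dist2 a b <= e -> U b) -> compact U.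
Proof.
move=> Ac e0 UA Ue; apply: (subclosed_compact _ Ac UA) => x Ux.
have Ax : A x.
  by apply: compact_closed Ac _ (closure_subset UA Ux); exact: norm_hausdorff.
have [y [Uy /= xy]] := Ux _ (near_dist2 x e0).
by apply: Ue Uy Ax _; rewrite dist2C ltW.
Qed.

(** Both [U] and its complement in [A] are compact, so their distance is attained, and saturation
    makes the attained value exceed [e]. This is where the strict inequality in [eps_component]
    comes from. *)
Lemma set_dist_saturated A U e : compact A -> 0 < e -> U `<=` A ->
  (forall a b, U a -> A b -> dist2 a b <= e -> U b) ->
  (e%:E < set_dist U (A `\` U))%E.
Proof.
move=> Ac e0 UA Ue.
(* If one side is empty, the distance is an infimum over the empty set, that is [+oo]. *)
have [AU0|/set0P AU0] := eqVneq (U `*` (A `\` U)) set0.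
  by rewrite /set_dist AU0 image_set0 ereal_inf0 ltry.
have Uc : compact U by exact: compact_saturated Ue.
have AUc : compact (A `\` U).
  apply: (compact_saturated Ac e0) => [x []//|a b [Aa nUa] Ab ab].
  by split=> // Ub; apply: nUa; apply: Ue Ub Aa _; rewrite dist2C.
have cd := continuous_subspaceT (@dist2_continuous R d).
have [[x y] /set_mem[/= Ux [Ay nUy]] xym] :=
  compact_EVT_min AU0 (compact_setX Uc AUc) (cd _).
apply: (@lt_le_trans _ _ (dist2 x y)%:E).
  by rewrite lte_fin ltNge; apply/negP => /(Ue _ _ Ux Ay).
apply: le_ereal_inf_tmp => _ [p pU <-]; rewrite lee_fin; apply: (xym p).
exact/mem_set.
Qed.

(** The birth scale is dropped, since the vertices are all the points of [A] at every scale
    [s >= 0]. *)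
Definition separated A n t := exists2 v : 'I_n -> E, (forall i, A (v i)) &
  forall i j, connected_in (cech A t) (v i) (v j) -> i = j.

Lemma connected_in_cech_sub A x y t : connected_in (cech A t) x y -> A x -> A y.
Proof. by apply=> a b _ /cech_edge[]. Qed.

Lemma separated_fin A t (I : finType) (v : I -> E) : (forall i, A (v i)) ->
  (forall i j, connected_in (cech A t) (v i) (v j) -> i = j) -> separated A #|I| t.
Proof.
move=> vA vI; exists (v \o enum_val) => [i|i j /vI /enum_val_inj//]; exact: vA.
Qed.

Lemma separated_le A m n s t : (m <= n)%N -> s <= t ->
  separated A n t -> separated A m s.
Proof.
move=> mn st [v vA vI]; exists (v \o widen_ord mn) => [i|i j ij]; first exact: vA.
suff /vI/(congr1 val)/= /val_inj :
  connected_in (cech A t) (v (widen_ord mn i)) (v (widen_ord mn j)) by [].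
apply: (connected_in_map (g := id) _ ij) => a b /cech_edge[s0 Aa Ab ab].
apply: connected_in_edge; apply/cech_edge; split=> //; exact: le_trans st.
Qed.

Lemma separated1 A t : A !=set0 -> separated A 1 t.
Proof. by move=> [a Aa]; exists (fun=> a) => // i j; rewrite !ord1. Qed.

Lemma separated_dist A n t : 0 <= t -> (1 < n)%N -> separated A n t ->
  exists x y, [/\ A x, A y & t < dist2 x y].
Proof.
move=> t0 n1 [v vA vI]; pose i0 := Ordinal (ltnW n1); pose i1 := Ordinal n1.
exists (v i0), (v i1); split=> //; rewrite ltNge; apply/negP => le_t.
suff /vI : connected_in (cech A t) (v i0) (v i1) by [].
by apply: connected_in_edge; apply/cech_edge.
Qed.

(** A component that meets another one without being contained in it would be split by it into two
    nonempty parts at distance more than [e]. *)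
Lemma eps_component_inj A e X Y : eps_component A e X -> eps_component A e Y ->
  X `&` Y !=set0 -> X = Y.
Proof.
have sub X' Y' : eps_component A e X' -> eps_component A e Y' ->
    X' `&` Y' !=set0 -> X' `<=` Y'.
  move=> [XA _ Xe _] [YA _ _ Yd] XY0; apply: contrapT => XY.
  apply: Xe; exists (X' `&` Y'), (X' `\` Y'); split=> //.
  - by apply/set0P/eqP; rewrite setD_eq0.
  - by rewrite setUIDK.
  apply: (lt_le_trans Yd); apply: le_ereal_inf => _ [[x y] [/= [Xx Yx] [Xy nYy]] <-].
  by exists (x, y) => //; split=> //; split=> //; exact: XA.
move=> Xe Ye XY0; apply/seteqP; split; apply: sub => //.
by rewrite setIC.
Qed.

Lemma eps_component_connected A e X x y : eps_component A e X ->
  connected_in (cech A e) x y -> X x -> X y.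
Proof.
move=> [XA _ _ Xd]; apply=> a b Xa /cech_edge[_ Aa Ab ab]; apply: contrapT => nXb.
have := lt_le_trans Xd (set_dist_le Xa (conj Ab nXb)).
by rewrite lte_fin ltNge ab.
Qed.

(** Compactness provides the gap to the rest of [A]. For connectedness, no edge crosses a splitting
    at distance greater than [e], so a path starting on one side never reaches the other. *)
Lemma connected_component A e x : compact A -> 0 < e -> A x ->
  eps_component A e [set y | connected_in (cech A e) x y].
Proof.
move=> Ac e0 Ax; set X := [set y | _].
have XA : X `<=` A by move=> y /connected_in_cech_sub; exact.
have step a b : X a -> A b -> dist2 a b <= e -> X b.
  move=> Xa Ab ab; apply: (connected_in_trans Xa); apply: connected_in_edge.
  by apply/cech_edge; split=> //; [exact: ltW|exact: XA Xa].
split=> //; first by exists x.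
  2: exact: set_dist_saturated.
move=> [Y [Z [[y Yy] [z Zz] XYZ YZe]]].
have Xy : X y by rewrite XYZ; left.
have Xz : X z by rewrite XYZ; right.
have nYZ a b : Y a -> Z b -> e < dist2 a b.
  by move=> Ya Zb; rewrite -lte_fin (lt_le_trans YZe)// set_dist_le.
suff Yz : Y z by have := nYZ _ _ Yz Zz; rewrite dist2xx ltNge ltW.
have : connected_in (cech A e) y z.
  by apply: connected_in_trans Xz; exact: connected_in_sym.
apply=> // a b Ya /cech_edge[_ Aa Ab ab].
have : X b by apply: step ab => //; rewrite XYZ; left.
rewrite XYZ => -[//|/(nYZ _ _ Ya)]; by rewrite ltNge ab.
Qed.

Lemma num_components_geP A n e : compact A -> 0 < e ->
  (n%:R%:E <= num_components A e)%E <-> separated A n e.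
Proof.
move=> Ac e0; rewrite /num_components counting_geP; split=> [[Y YI YC]|[v vA vI]].
  have Y0 i : exists y, Y i y by have [] := YC i.
  have [v vY] := choice Y0; exists v => [i|i j ij].
    by have [YA _ _ _] := YC i; exact: YA.
  apply: YI; apply: eps_component_inj (YC i) (YC j) _; exists (v j); split=> //.
  exact: eps_component_connected (YC i) ij (vY i).
exists (fun i => [set y | connected_in (cech A e) (v i) y]) => [i j ij|i].
  apply: vI; have : [set y | connected_in (cech A e) (v j) y] (v j) by [].
  by rewrite -ij.
exact: connected_component.
Qed.

Lemma cech_rank_ge A n s t : (0 < n)%N ->
  (n%:R%:E <= cech_rank 0 A s t)%E <-> [/\ 0 <= s, s <= t & separated A n t].
Proof.
move=> n0; rewrite /cech_rank; case: pselect => [st|nst]; last first.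
  by split=> [|[]//]; rewrite lee_fin lern0 eqn0Ngt n0.
rewrite rank_H0_ge; split=> [[v [vA vI]]|[s0 _ [v vA vI]]].
  split=> //; first by have /cech_vertex[] := vA (Ordinal n0).
  by exists v => // i; have /cech_vertex[] := vA i.
by exists v; split=> // i; apply/cech_vertex.
Qed.

(** From scale [diam A] on, all points are joined, so the rank is at most 1 and the correction
    removes it; below that scale the rank is unchanged. *)
Lemma kill_essential_rank_ge A n s t : A !=set0 -> compact A -> (0 < n)%N ->
  (n%:R%:E <= kill_essential (fine (diam A)) (cech_rank 0 A) s t)%E <->
  [/\ 0 <= s, s <= t, t < fine (diam A) & separated A n t].
Proof.
move=> A0 Ac n0; have [x [y [Ax Ay -> xyM]]] := diam_attained A0 Ac.
have small k : (1 < k)%N -> 0 <= t -> separated A k t -> t < dist2 x y.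
  move=> k1 t0 /(separated_dist t0 k1)[x' [y' [Ax' Ay' /lt_le_trans]]].
  by apply; exact: xyM.
rewrite /kill_essential; case: ifPn => [/and3P[s0 st Dt]|nD].
  rewrite leeBrDr// -EFinD natr1 cech_rank_ge//; split=> [[_ _]|[_ _]].
    by move=> /small; rewrite ltnS n0 ltNge Dt => /(_ isT (le_trans s0 st)).
  by rewrite ltNge Dt.
rewrite cech_rank_ge//; split=> [[s0 st An]|[]//]; split=> //.
by move: nD; rewrite s0 st /= -ltNge.
Qed.

End Components.

(** A nonempty [T] is an interval from 0 to [sup T], with or without its upper end. The admissible
    [m] satisfy [0 <= m <= x] and [x + m] in [T]; if there are any, their supremum is the minimum of
    [x] and [sup T - x]. *)
Lemma landscape_hat (R : realType) (r : R -> R -> \bar R) n (T : set R) x :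
  (forall s t, (n%:R%:E <= r s t)%E <-> [/\ 0 <= s, s <= t & T t]) ->
  (forall s t, 0 <= s -> s <= t -> T t -> T s) ->
  (forall t, T t -> 0 <= t) -> has_ubound T ->
  landscape r n x = hat (sup T) x.
Proof.
move=> rT Tdown T0 Tub; rewrite /landscape /hat.
have -> : [set m | 0 <= m /\ (n%:R%:E <= r (x - m)%R (x + m)%R)%E] =
    [set m | [/\ 0 <= m, m <= x & T (x + m)]].
  apply/seteqP; split=> m /= [].
    by move=> m0 /rT[]; rewrite subr_ge0.
  by move=> m0 mx Tm; split=> //; apply/rT; split=> //; [rewrite subr_ge0|lra].
have [[x0 Tx]|nTx] := pselect (0 <= x /\ T x); last first.
  (* No [m] is admissible: the supremum takes its default value 0, and the hat function vanishes at
     [x] too. *)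
  have -> : [set m | [/\ 0 <= m, m <= x & T (x + m)]] = set0.
    apply/seteqP; split=> // m [m0 mx Tm]; apply: nTx.
    have x0 : 0 <= x by exact: le_trans mx.
    by split=> //; apply: Tdown Tm => //; rewrite lerDl.
  rewrite sup0; apply/esym/max_idPl; rewrite ge_min.
  have [//|x0] := leP x 0; rewrite subr_le0 /=.
  have [->|/set0P T_neq0] := eqVneq T set0; first by rewrite sup0 ltW.
  apply: ge_sup => // t Tt; rewrite leNgt; apply/negP => xt; apply: nTx.
  by split; [exact: ltW|exact: Tdown (ltW x0) (ltW xt) Tt].
have xT : x <= sup T by exact: ub_le_sup.
rewrite (max_idPr _); last by rewrite le_min x0 subr_ge0.
have S0 : [set m | [/\ 0 <= m, m <= x & T (x + m)]] 0 by split=> //; rewrite addr0.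
apply/eqP; rewrite eq_le; apply/andP; split.
  apply: ge_sup; first by exists 0.
  move=> m [m0 mx Tm]; rewrite le_min mx lerBrDl.
  exact: ub_le_sup.
rewrite leNgt; apply/negP; set S := sup _ => Slt.
have Sub : has_ubound [set m | [/\ 0 <= m, m <= x & T (x + m)]].
  by exists x => m [].
have S_ge0 : 0 <= S by exact: ub_le_sup.
(* The midpoint is admissible, yet lies above the supremum [S]. *)
pose m := (S + Num.min x (sup T - x)) / 2.
have [Sm mlt] : S < m /\ m < Num.min x (sup T - x) by rewrite /m; lra.
have : m <= S.
  apply: ub_le_sup => //; move: mlt; rewrite lt_min => /andP[mx mT].
  have m0 : 0 <= m by lra.
  split=> //; first exact: ltW.
  have [t Tt xmt] : exists2 t, T t & x + m < t.
    by apply: sup_gt; [exists x|lra].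
  by apply: Tdown Tt; [lra|exact: ltW].
by rewrite leNgt Sm.
Qed.

Lemma counting_leNgt (R : realType) (T : choiceType) (S : set T) n :
  (counting S <= n%:R%:E :> \bar R)%E = ~~ (n.+1%:R%:E <= counting S :> \bar R)%E.
Proof.
rewrite /counting; case: asboolP => _; last by rewrite leey leye_eq.
by rewrite !lee_fin !ler_nat -ltnNge ltnS.
Qed.

(** * Death times *)

Section Death.
Context (R : realType) (d : nat).
Local Notation E := 'rV[R]_d.
Implicit Types (A : set E) (n : nat) (t : R).

(* The [n]-th largest death time, or 0 if there are fewer than [n] of them; the
   class that never dies is included, with death time [diam A]. *)
Definition death A n : R :=
  sup [set t | [/\ 0 <= t, t < fine (diam A) & separated A n t]].

Lemma death_has_ubound A n :
  has_ubound [set t | [/\ 0 <= t, t < fine (diam A) & separated A n t]].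
Proof. by exists (fine (diam A)) => t [_ /ltW]. Qed.

Lemma le_death A n t : 0 <= t -> t < fine (diam A) -> separated A n t ->
  t <= death A n.
Proof. by move=> t0 tD An; apply: ub_le_sup; [exact: death_has_ubound|]. Qed.

Lemma death_le A n b : 0 <= b ->
  (forall t, 0 <= t -> t < fine (diam A) -> separated A n t -> t <= b) ->
  death A n <= b.
Proof.
move=> b0 Ab; rewrite /death; set T := [set t | _].
have [->|/set0P T0] := eqVneq T set0; first by rewrite sup0.
by apply: ge_sup => // t [t0 tD] /Ab; exact.
Qed.

Lemma death_ge0 A n : 0 <= death A n.
Proof.
rewrite /death; set T := [set t | _].
have [->|/set0P[t Tt]] := eqVneq T set0; first by rewrite sup0.
by have [t0 tD An] := Tt; exact: le_trans t0 (le_death t0 tD An).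
Qed.

Lemma diam_ge0 A : 0 <= fine (diam A).
Proof.
have [->|/set0P[a Aa]] := eqVneq A set0.
  (* The supremum over the empty set is [-oo], which [fine] sends to 0. *)
  by rewrite /diam setX0 image_set0 ereal_sup0.
by apply: fine_ge0; apply: le_trans (diam_ge Aa Aa); rewrite lee_fin dist2_ge0.
Qed.

Lemma death_le_diam A n : death A n <= fine (diam A).
Proof. by apply: death_le => [|t _ /ltW//]; exact: diam_ge0. Qed.

Lemma H0_landscape_hat A n x : A !=set0 -> compact A -> (0 < n)%N ->
  H0_landscape A n x = hat (death A n) x.
Proof.
move=> A0 Ac n0; apply: landscape_hat.
- move=> s t; rewrite kill_essential_rank_ge//; split=> [[s0 st tD An]|[s0 st []]//].
  by split=> //; split=> //; exact: le_trans st.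
- move=> s t s0 st [t0 tD An]; split=> //; first exact: le_lt_trans tD.
  exact: separated_le An.
- by move=> t [].
- exact: death_has_ubound.
Qed.

Lemma separated_lt_diam A n t : A !=set0 -> compact A -> (1 < n)%N -> 0 <= t ->
  separated A n t -> t < fine (diam A).
Proof.
move=> A0 Ac n1 t0 /(separated_dist t0 n1)[x [y [Ax Ay]]] /lt_le_trans; apply.
have [x' [y' [_ _ -> ->//]]] := diam_attained A0 Ac.
Qed.

(** For [n = 1] separation always holds and only the bound by the diameter remains. For [n >= 2],
    the positive scales with at most [n - 1] components are those at which no [n] points are
    separated. Separation passes to smaller scales, so the infimum of these scales is the supremum
    of the others. *)
Lemma delta_death A n : A !=set0 -> compact A -> (0 < n)%N ->
  delta A n = death A n.
Proof.
move=> A0 Ac; rewrite leq_eqVlt => /predU1P[<-|n1].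
  rewrite /delta eqxx; apply/eqP; rewrite eq_le death_le_diam andbT leNgt.
  apply/negP => lt_D; have := death_ge0 A 1; rewrite leNgt => /negP; apply.
  suff : (death A 1 + fine (diam A)) / 2 <= death A 1 by lra.
  by apply: le_death; [have := death_ge0 A 1; lra|lra|exact: separated1].
have n0 := ltnW n1.
rewrite /delta gtn_eqF//; set S := [set e | _].
have SP e : S e <-> 0 < e /\ ~ separated A n e.
    rewrite /S/= /num_components counting_leNgt prednK//.
  split=> -[e0 H]; split=> //.
    by move/(num_components_geP _ Ac e0); exact/negP.
  by apply/negP => /(num_components_geP _ Ac e0).
(* Beyond the diameter no two points are separated, so the infimum is over a nonempty set. *)
have SD : S (fine (diam A) + 1).
  apply/SP; split; first by rewrite ltr_wpDl// diam_ge0.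
  move/separated_lt_diam => /(_ A0 Ac n1); have := diam_ge0 A; lra.
apply/eqP; rewrite eq_le; apply/andP; split; last first.
  apply: lb_le_inf; first by exists (fine (diam A) + 1).
  move=> e /SP[e0 nAe]; apply: death_le => [|t t0 tD At]; first exact: ltW.
  rewrite leNgt; apply/negP => et; apply: nAe; exact: separated_le (ltW et) At.
apply/ler_addgt0Pr => e e0.
have De : 0 < death A n + e by rewrite ltr_wpDl// death_ge0.
apply: ge_inf; first by exists 0 => ? /SP[/ltW].
apply/SP; split=> // An.
have := le_death (ltW De) (separated_lt_diam A0 Ac n1 (ltW De) An) An.
by rewrite leNgt ltrDl e0.
Qed.

End Death.

(** * Self-similarity of the death times *)

Section SelfSimilar.
Context (R : realType) (d N : nat) (c : R) (psi : 'I_N -> 'rV[R]_d -> 'rV[R]_d).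
Context (A : set 'rV[R]_d).
Hypotheses (c0 : 0 < c) (psi_sim : forall i, similitude c (psi i)).
Hypothesis A_inv : invariant_set psi A.

Let A_psi i x : A x -> A (psi i x).
Proof. by move=> Ax; have [_ _ ->] := A_inv; exists i => //; exists x. Qed.

(** By pigeonhole, one piece holds at least [k + 1] of the points. As [psi j] carries edges at scale
    [t / c] to edges at scale [t], preimages of separated points are separated. *)
Lemma separated_contract n k t : (N * k < n)%N -> separated A n t ->
  separated A k.+1 (t / c).
Proof.
move=> kn [v vA vI]; have [_ _ AE] := A_inv.
have vP i : exists p : 'I_N * 'rV[R]_d, A p.2 /\ psi p.1 p.2 = v i.
  by have := vA i; rewrite {1}AE => -[j _ [x Ax xv]]; exists (j, x).
have [p pP] := choice vP.
have [j jk] : exists j, (k < #|[pred i | (p i).1 == j]|)%N.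
  apply: contrapT => /forallNP small; move: kn; apply/negP; rewrite -leqNgt.
  rewrite -{1}(card_ord n) -sum1_card (partition_big (fun i => (p i).1) predT)//=.
  have -> : (N * k = \sum_(j < N) k)%N by rewrite sum_nat_const card_ord.
  apply: leq_sum => j _.
  by rewrite sum1_card leqNgt; apply/negP/small.
apply: (separated_le (n := #|[pred i | (p i).1 == j]|) jk (lexx _)).
rewrite -card_sig; apply: (separated_fin (v := fun i => (p (val i)).2)) => [i|i i' ii'].
  by have [] := pP (val i).
apply/val_inj/vI; have [Ai <-] := pP (val i); have [Ai' <-] := pP (val i').
rewrite (eqP (valP i)) (eqP (valP i')).
apply: (connected_in_map (g := psi j) _ ii') => a b /cech_edge[tc0 Aa Ab ab].
apply: connected_in_edge; apply/cech_edge; split; [|exact: A_psi|exact: A_psi|].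
  by move: tc0; rewrite pmulr_lge0// invr_gt0.
by rewrite psi_sim -ler_pdivlMl// mulrC.
Qed.

Hypothesis psi_sep : well_separated psi A.

(** The length [c * dist2 p q] is realised inside the piece of index [i], so it is at most the
    diameter of a piece, hence at most the gap between two pieces. *)
Lemma well_separated_dist i j x y p q : i != j -> A x -> A y -> A p -> A q ->
  c * dist2 p q <= dist2 (psi i x) (psi j y).
Proof.
move=> ij Ax Ay Ap Aq; rewrite -(psi_sim i) -lee_fin.
apply: (@le_trans _ _ (diam (psi i @` A))); first by apply: diam_ge; exact: imageP.
apply: (@le_trans _ _ (\big[maxe/-oo]_(j < N) diam (psi j @` A))%E).
  exact: (le_bigmax _ (fun j => diam (psi j @` A))).
apply: (le_trans psi_sep).
apply: (@le_trans _ _ (set_dist (psi i @` A) (psi j @` A))).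
  exact: (@bigmin_le_cond _ _ _ _ (i, j) (fun jk : 'I_N * 'I_N => jk.1 != jk.2)
   (fun jk => set_dist (psi jk.1 @` A) (psi jk.2 @` A))).
by apply: set_dist_le; exact: imageP.
Qed.

(** Two components at scale [t] provide points of [A] further apart than [t], so distinct pieces are
    more than [c * t] apart. Edges at scale [c * t] thus stay in one piece, and the separated points
    can be copied into all [N] pieces. *)
Lemma separated_expand k t : 0 <= t -> (1 < k)%N -> separated A k t ->
  separated A (N * k) (c * t).
Proof.
move=> t0 k1 Ak; have [p [q [Ap Aq tpq]]] := separated_dist t0 k1 Ak.
have [v vA vI] := Ak.
have far i j x y : A x -> A y -> dist2 (psi i x) (psi j y) <= c * t -> i = j.
  move=> Ax Ay le_ct; apply/eqP; apply: contraT => ij.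
  have := le_trans (well_separated_dist ij Ax Ay Ap Aq) le_ct.
  by rewrite ler_pM2l// leNgt tpq.
rewrite -{1}(card_ord N) -{1}(card_ord k) -card_prod.
apply: (separated_fin (v := fun ij => psi ij.1 (v ij.2))) => [ij|[i j] [i' j'] /= ij].
  exact/A_psi/vA.
(* The path from [psi i (v j)] lifts edge by edge to a path from [v j] at scale [t]. *)
have [x [jx xE]] : exists x, connected_in (cech A t) (v j) x /\ psi i x = psi i' (v j').
  apply: (ij (fun y => exists x, connected_in (cech A t) (v j) x /\ psi i x = y)).
    move=> _ b [x [jx <-]] /cech_edge[_ _ Ab ab]; have [_ _ AE] := A_inv.
    have Ax := connected_in_cech_sub jx (vA j).
    move: Ab ab; rewrite {1}AE => -[i'' _ [y Ay <-]] xy.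
    have i''E := far _ _ _ _ Ax Ay xy; rewrite -i''E in xy *; exists y; split=> //.
    apply: (connected_in_trans jx); apply: connected_in_edge; apply/cech_edge.
    by split=> //; rewrite psi_sim ler_pM2l// in xy.
  by exists (v j); split=> [|//]; exact: connected_in_refl.
have Ax := connected_in_cech_sub jx (vA j).
have ii' : i = i'.
  apply: (far _ _ _ _ Ax (vA j')); rewrite xE dist2xx mulr_ge0//; exact: ltW.
rewrite -ii' in xE *.
(* A similitude with [c > 0] is injective. *)
have xj' : x = v j'.
  apply: dist2_eq0; apply/eqP; rewrite -(mulrI_eq0 _ (mulfI (lt0r_neq0 c0))).
  by rewrite -(psi_sim i) xE dist2xx.
by rewrite xj' in jx; rewrite (vI _ _ jx).
Qed.

(** Contraction and expansion give the two inequalities. As [k >= 1], both numbers of points are at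
    least 2, so the rescaled scales satisfy the bound by the diameter required in [death]. *)
Lemma death_scale n k : (0 < k)%N -> (N * k < n)%N -> (n <= N * k.+1)%N ->
  death A n = c * death A k.+1.
Proof.
move=> k0 kn nk; have [A0 Ac _] := A_inv; apply/eqP; rewrite eq_le; apply/andP; split.
  apply: death_le => [|t t0 tD An]; first by rewrite mulr_ge0 ?death_ge0// ltW.
  rewrite -ler_pdivrMl// mulrC.
  have tc0 : 0 <= t / c by rewrite divr_ge0// ltW.
  have Ak := separated_contract kn An.
  by apply: le_death => //; exact: separated_lt_diam Ak.
rewrite -ler_pdivlMl//; apply: death_le => [|t t0 tD Ak].
  by rewrite mulr_ge0 ?death_ge0// invr_ge0 ltW.
rewrite ler_pdivlMl//.
have An : separated A n (c * t).
  by apply: (separated_le nk (lexx _)); exact: separated_expand.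
have ct0 : 0 <= c * t by rewrite mulr_ge0// ltW.
apply: le_death => //; apply: separated_lt_diam An => //.
have : (0 < N * k.+1)%N by rewrite (leq_trans _ nk)// (leq_ltn_trans _ kn).
by rewrite muln_gt0 => /andP[N0 _]; rewrite (leq_trans _ kn)// ltnS muln_gt0 N0.
Qed.

End SelfSimilar.

(** * The landscape as a fixed point *)

Lemma rescale_hat (R : realType) (c b : R) : 0 < c -> rescale c (hat b) = hat (c * b).
Proof.
move=> c0; apply/funext => x; rewrite /rescale /hat maxr_pMr ?minr_pMr ?ltW// mulr0.
by rewrite mulrBr mulVKf// lt0r_neq0.
Qed.

Lemma hat_Linfty_bounded (R : realType) (b : nat -> R) (D : R) :
  (forall n, `|b n| <= D) ->
  (ereal_sup (range (fun n =>
    'N[@lebesgue_measure R]_+oo[EFin \o (ess_pi (hat (b n)) : R -> R)])) < +oo)%E.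
Proof.
move=> bD; apply: (@le_lt_trans _ _ D%:E); last exact: ltry.
apply: ub_ereal_sup => _ [n _ <-]; apply: Lnorm_ley.
  apply: (@filterS _ _ (ae_filter_ringOfSetsType lebesgue_measure)) (ess_piK (hat (b n))).
  by move=> x ->; exact: le_trans (hat_le _ _) (bD n).
exact: le_trans (normr_ge0 _) (bD 0).
Qed.

Theorem theorem4 (R : realType) (d N : nat) (d_gt0 : (0 < d)%N)
    (c : R) (c01 : 0 < c < 1)
    (psi : 'I_N -> 'rV[R]_d -> 'rV[R]_d)
    (psi_sim : forall i, similitude c (psi i))
    (A : set 'rV[R]_d) (A_inv : invariant_set psi A)
    (psi_sep : well_separated psi A) :
  exists f : Linfty R,
    represents f (H0_landscape A) /\ landscape_op N c (delta A) f = f.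
Proof.
have [A0 Ac AE] := A_inv; have /andP[c0 _] := c01.
(* A point of the nonempty [A] lies in some piece, so there is an index. *)
have N0 : (0 < N)%N.
  by have [a] := A0; rewrite AE => -[i _ _]; exact: leq_ltn_trans (ltn_ord i).
have bD n : `|death A n.+1| <= fine (diam A).
  by rewrite ger0_norm ?death_ge0// death_le_diam.
exists (MkLinfty (hat_Linfty_bounded bD)); split=> [n|].
  apply: (@filterS _ _ (ae_filter_ringOfSetsType lebesgue_measure))
    (ess_piK (hat (death A n.+1))).
  by move=> x /= ->; rewrite H0_landscape_hat.
apply: Linfty_inj => n; have [nN|Nn] := ltnP n N.
  by rewrite landscape_op_head// delta_death.
rewrite [in LHS](divn_eq n N).
rewrite (@landscape_op_tail _ _ _ _ _ _ _ (hat (death A (n %/ N).+1)))//=; last 3 first.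
- by rewrite divn_gt0.
- by rewrite ltn_mod.
- exact: ess_piK.
apply: ess_pi_eq; apply: aeW => x /=; rewrite rescale_hat//; congr (hat _ x).
(* Entry [n] stands for component [n + 1], which lies in the block from [N * k + 1] to [N * (k + 1)]
   for [k = n %/ N]. *)
apply/esym/(death_scale c0 psi_sim A_inv psi_sep); first by rewrite divn_gt0.
  by rewrite ltnS mulnC leq_trunc_div.
by rewrite mulnC -ltn_divLR.
Qed.
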